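(* Let $(\mathcal{N},\mathcal{I})$ be a matroid with $|\mathcal{N}|=n$ and rank $r$, let $f:2^{\mathcal{N}}\to\mathbb{R}$ be a non-monotone, non-negative submodular function, and let $\epsilon\in(0,1)$. Then the deterministic algorithm TwinGreedyFast (described in the context), run on $(\mathcal{N},\mathcal{I},f,\epsilon)$, returns a solution $S^*\in\mathcal{I}$ with $\frac14-\epsilon$ approximation ratio for the problem $\max\{f(S):S\in\mathcal{I}\}$, i.e. $f(S^* )\ge\left(\frac14-\epsilon\right)\max\{f(S):S\in\mathcal{I}\}$, and its time complexity is $\mathcal{O}\left(\frac{n}{\epsilon}\log\frac{r}{\epsilon}\right)$.
   Context: Submodular: $f(X)+f(Y)\ge f(X\cup Y)+f(X\cap Y)$ for all $X,Y\subseteq\mathcal{N}$. Non-negative: $f(X)\ge 0$ for all $X$. Non-monotone: there exist $X\subset Y\subseteq\mathcal{N}$ with $f(X)>f(Y)$. Marginal gain: $f(X\mid Y)=f(X\cup Y)-f(Y)$, and $f(x\mid Y)=f(\{x\}\mid Y)$; $f(e)=f(\{e\})$. $\mathcal{N}$ is finite, $\mathcal{I}\subseteq 2^{\mathcal{N}}$ is the family of independent sets, and $r=\max\{|S|:S\in\mathcal{I}\}\ge 1$. Algorithm TwinGreedyFast: let $\tau_{\max}=\max\{f(e):e\in\mathcal{N},\{e\}\in\mathcal{I}\}$ and $S_1=S_2=\emptyset$. For $\tau=\tau_{\max},\ \tau_{\max}/(1+\epsilon),\ \tau_{\max}/(1+\epsilon)^2,\dots$, as long as $\tau>\epsilon\tau_{\max}/[r(1+\epsilon)]$,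 do the following: go through the elements $e\in\mathcal{N}\setminus(S_1\cup S_2)$ one by one in arbitrary order; for each such $e$ set, for $j\in\{1,2\}$, $\Delta_j=f(e\mid S_j)$ if $S_j\cup\{e\}\in\mathcal{I}$ and $\Delta_j=-\infty$ otherwise (with the current $S_1,S_2$); let $i\in\arg\max_{j\in\{1,2\}}\Delta_j$ (ties broken arbitrarily); if $\Delta_i\ge\tau$, replace $S_i$ by $S_i\cup\{e\}$. At the end return $S^*\in\arg\max_{X\in\{S_1,S_2\}}f(X)$. Time complexity is measured with $f$ and membership in $\mathcal{I}$ given by oracles, each evaluation of $f$ and each test of membership in $\mathcal{I}$ counting as one step; $\mathcal{O}(\cdot)$ hides an absolute constant and is understood for $r/\epsilon$ bounded away from $1$ (say $r/\epsilon\ge 2$). *)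

(* Defs.v *)
From HB Require Import structures.
From mathcomp Require Import all_boot all_order all_algebra.
From mathcomp Require Import reals constructive_ereal exp.

Set Implicit Arguments.
Unset Strict Implicit.
Unset Printing Implicit Defensive.

Import Order.TTheory GRing.Theory Num.Theory.
Local Open Scope ring_scope.

Section Matroid.
Context {T : finType}.
Implicit Types (I : {set {set T}}) (X Y : {set T}).

Definition matroid I : Prop :=
  [/\ set0 \in I,
      (forall X Y, X \subset Y -> Y \in I -> X \in I) &
      (forall X Y, X \in I -> Y \in I -> (#|X| < #|Y|)%N ->
         exists2 e, e \in Y :\: X & e |: X \in I)].

Definition rank I : nat := \max_(X in I) #|X|.

End Matroid.

Section SetFunction.
Context {R : realType} {T : finType}.
Implicit Types (f : {set T} -> R) (I : {set {set T}}).

Definition submodular f : Prop :=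
  forall X Y, f X + f Y >= f (X :|: Y) + f (X :&: Y).

Definition nonnegative f : Prop := forall X, 0 <= f X.

Definition nonmonotone f : Prop :=
  exists X Y : {set T}, X \proper Y /\ f X > f Y.

(* The base point f set0 is harmless, since set0 is independent in a matroid. *)
Definition opt f I : R := \big[Num.max/f set0]_(X in I) f X.

End SetFunction.

(* Programs that reach the set function and the independence system only      *)
(* through oracle queries. [Choose P k] is an arbitrary choice of a value     *)
(* satisfying P; it costs nothing.                                            *)
Inductive prog (R : Type) (T : finType) (A : Type) : Type :=
| Ret of A
| EvalF of {set T} & (R -> prog R T A)
| TestI of {set T} & (bool -> prog R T A)
| Choose (B : Type) (P : B -> Prop) of (B -> prog R T A).

Arguments Ret {R T A} _.
Arguments EvalF {R T A} _ _.
Arguments TestI {R T A} _ _.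
Arguments Choose {R T A B} P _.

Fixpoint bind {R : Type} {T : finType} {A B : Type}
    (p : prog R T A) (q : A -> prog R T B) : prog R T B :=
  match p with
  | Ret a => q a
  | EvalF X k => EvalF X (fun y => bind (k y) q)
  | TestI X k => TestI X (fun b => bind (k b) q)
  | Choose _ P k => Choose P (fun c => bind (k c) q)
  end.

(* [all_runs f I p t Q]: started when t queries have been made, p never gets  *)
(* stuck at a choice and, however the choices are resolved, it ends with a    *)
(* result a and a total number t' of queries such that Q a t'.                *)
Fixpoint all_runs {R : Type} {T : finType} {A : Type}
    (f : {set T} -> R) (I : {set {set T}}) (p : prog R T A) (t : nat)
    (Q : A -> nat -> Prop) : Prop :=
  match p with
  | Ret a => Q a t
  | EvalF X k => all_runs f I (k (f X)) t.+1 Q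
  | TestI X k => all_runs f I (k (X \in I)) t.+1 Q
  | Choose _ P k =>
      (exists c, P c) /\ (forall c, P c -> all_runs f I (k c) t Q)
  end.

Section TwinGreedyFast.
Context {R : realType} {T : finType}.
Variables (eps : R) (r : nat).

(* The two solutions S_1, S_2 are S false, S true. *)
Implicit Types (S : bool -> {set T}) (e : T) (s : seq T) (tau : R).

Definition is_argmax {d : Order.disp_t} {D : porderType d} (v : bool -> D)
    (i : bool) : Prop :=
  forall j, (v j <= v i)%O.

Fixpoint singleton_values s : prog R T (seq R) :=
  if s is e :: s' then
    TestI [set e] (fun b =>
      if b then
        EvalF [set e] (fun y =>
          bind (singleton_values s') (fun ys => Ret (y :: ys)))
      else singleton_values s')
  else Ret [::].

(* The maximum when ys is nonempty; ys is empty only in rank 0. *)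
Definition seq_max (ys : seq R) : R := \big[Num.max/head 0 ys]_(y <- ys) y.

(* The marginal gain f(e | X), or -oo if X :|: [set e] is not independent.    *)
Definition gain (X : {set T}) e : prog R T (\bar R) :=
  TestI (X :|: [set e]) (fun b =>
    if b then
      EvalF (X :|: [set e]) (fun y => EvalF X (fun x => Ret (y - x)%:E))
    else Ret -oo%E).

Definition process tau S e : prog R T (bool -> {set T}) :=
  bind (gain (S false) e) (fun d1 =>
  bind (gain (S true) e) (fun d2 =>
  let Delta j := if j then d2 else d1 in
  Choose (is_argmax Delta) (fun i =>
  Ret (if (tau%:E <= Delta i)%E
       then fun j => if j == i then S j :|: [set e] else S j
       else S)))).

Fixpoint scan tau s S : prog R T (bool -> {set T}) :=
  if s is e :: s' then bind (process tau S e) (scan tau s') else Ret S.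

(* Drawing the whole order at the start of the pass loses no run: the order   *)
(* and the ties are arbitrary, so it also covers orders chosen on the fly.    *)
Definition pass tau S : prog R T (bool -> {set T}) :=
  Choose (fun s => perm_eq s (enum (~: (S false :|: S true))))
    (fun s => scan tau s S).

(* The fuel bounds the number of passes; [None] means that it ran out before  *)
(* the threshold dropped to the bound.                                        *)
Fixpoint threshold_loop (fuel : nat) (bound tau : R) S
    : prog R T (option (bool -> {set T})) :=
  if bound < tau then
    if fuel is fuel'.+1 then
      bind (pass tau S) (threshold_loop fuel' bound (tau / (1 + eps)))
    else Ret None
  else Ret (Some S).

Definition best_of_two S : prog R T {set T} :=
  EvalF (S false) (fun y1 =>
  EvalF (S true) (fun y2 =>
  Choose (is_argmax (fun j => if j then y2 else y1)) (fun i => Ret (S i)))).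

Definition twin_greedy_fast (fuel : nat) : prog R T (option {set T}) :=
  bind (singleton_values (enum T)) (fun ys =>
  let tau_max := seq_max ys in
  bind (threshold_loop fuel (eps * tau_max / (r%:R * (1 + eps))) tau_max
          (fun=> set0))
    (fun o => if o is Some S' then bind (best_of_two S') (fun X => Ret (Some X))
              else Ret None)).

End TwinGreedyFast.

(* Main.v *)
(* Let O be optimal and f(x | S) = f(S + x) - f(S). As S_1 and S_2 are
   disjoint, submodularity gives f(O) <= f(O u S_1) + f(O u S_2), and f(O u
   S_i) - f(S_i) is at most the sum of f(x | S_i) over x in O \ S_i. While
   the algorithm runs, keep A_i inside O with S_i u A_i independent; an
   element x leaves A_i when it is selected, or when adding some e to S_i
   forces x out by a matroid exchange. In the first case f(x | S_i) is at
   most the gain of x on the side that took it; in the second case x is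
   unselected and feasible for S_i, so f(x | S_i) <= (1 + eps) tau, and tau
   is at most the gain of e. All losses are thus paid by gains, up to a
   factor 1 + eps. The only double charge, by an e in O that was forced out
   of A_i earlier and then enters S_i forcing out another element, is
   harmless: the loss of e disappears, and it had been estimated with a
   larger threshold. At the end the elements still in A_i lose at most eps
   tau_max / r each, whence (1 - 2 eps) f(O) <= (4 + 2 eps) f(X) for the
   returned set X. Since ln (1 + eps) >= eps / 2, there are O(ln (r / eps) /
   eps) passes of at most 6n queries each. *)

Require Import Defs.
From mathcomp Require Import all_boot all_order all_algebra.
From mathcomp Require Import reals constructive_ereal exp.
From mathcomp Require Import ring lra.

Set Implicit Arguments.
Unset Strict Implicit.
Unset Printing Implicit Defensive.

Import Order.TTheory GRing.Theory Num.Theory.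
Local Open Scope ring_scope.

(** * Matroid extension and exchange *)

Section Matroids.
Context {T : finType} {I : {set {set T}}}.
Hypothesis matI : matroid I.
Implicit Types (X Y A S : {set T}) (e : T).

Lemma indep0 : set0 \in I. Proof. by case: matI. Qed.

Lemma indepS X Y : X \subset Y -> Y \in I -> X \in I.
Proof. by case: matI => _ H _; apply: H. Qed.

Lemma indep_card_le_rank X : X \in I -> (#|X| <= rank I)%N.
Proof. by move=> XI; rewrite /rank (bigD1 X) //= leq_maxl. Qed.

Lemma indep_extend X Y : X \in I -> Y \in I -> (#|X| <= #|Y|)%N ->
  exists Z : {set T},
    [/\ X \subset Z, Z \subset X :|: Y, Z \in I & #|Z| = #|Y|].
Proof.
case: matI => _ _ augment.
move: {2}(#|Y| - #|X|)%N (erefl (#|Y| - #|X|)%N) => k.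
elim: k X => [|k IH] X dk XI YI leXY.
  exists X; split; rewrite ?subsetUl //.
  by apply/eqP; rewrite eqn_leq leXY /= -subn_eq0 dk.
have ltXY : (#|X| < #|Y|)%N by rewrite -subn_gt0 dk.
have [e /setDP[eY eX] eXI] := augment X Y XI YI ltXY.
have cX : #|e |: X| = #|X|.+1 by rewrite cardsU1 eX.
have [||||Z [eXZ ZXY ZI cZ]] := IH (e |: X); rewrite ?cX //.
  by rewrite subnS dk.
exists Z; split=> //; first by apply: subset_trans eXZ; apply: subsetUr.
apply: subset_trans ZXY _.
by rewrite -setUA subUset subxx andbT sub1set inE eY orbT.
Qed.

(** Extend S + e inside S + e + A to an independent Z with |Z| = |S u A|, and take A' = Z n A. Since
    Z contains at most one element outside S u A, namely e, it misses at most one element of S u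
    A. *)
Lemma indep_exchange S A e : S :|: A \in I -> S :|: [set e] \in I ->
  exists2 A' : {set T}, A' \subset A &
    (#|A :\: A'| <= 1)%N /\ (S :|: [set e]) :|: A' \in I.
Proof.
move=> SAI SeI.
have [le|lt] := leqP #|S :|: [set e]| #|S :|: A|; last first.
  (* If S + e is the larger set, then |S u A| <= |S|, so A adds nothing to S and nothing is
     displaced. *)
  have AS : A \subset S.
    have h : (#|S :|: A| <= #|S|)%N.
      rewrite -ltnS; apply: leq_trans lt _.
      by rewrite setUC cardsU1 -add1n leq_add2r leq_b1.
    have /eqP -> : S == S :|: A by rewrite eqEcard subsetUl.
    exact: subsetUr.
  exists A => //; rewrite setDv cards0; split=> //.
  by rewrite (setUidPl _) // (subset_trans AS) ?subsetUl.
have [Z [SZ ZS ZI cZ]] := indep_extend SeI SAI le.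
exists (Z :&: A); first exact: subsetIr.
split; last by apply: indepS ZI; rewrite subUset SZ subsetIl.
have ZSA : Z :\: (S :|: A) \subset [set e].
  apply/subsetP=> x /setDP[xZ]; rewrite !inE negb_or => /andP[xS xA].
  move/subsetP: ZS => /(_ x xZ).
  by rewrite !inE (negbTE xS) (negbTE xA) /= !orbF.
have AZ : A :\: (Z :&: A) \subset (S :|: A) :\: Z.
  by apply/subsetP=> x; rewrite !inE; do !case: (_ \in _).
apply: leq_trans (subset_leq_card AZ) _.
have -> : #|(S :|: A) :\: Z| = #|Z :\: (S :|: A)|.
  by rewrite !cardsD cZ setIC.
by rewrite -(cards1 e) subset_leq_card.
Qed.

End Matroids.

(** * Marginal gains of a submodular function *)

Section SubmodularFunctions.
Context {R : realType} {T : finType} {f : {set T} -> R}.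
Hypothesis subf : submodular f.
Implicit Types (X Y : {set T}) (x : T).

Lemma marginal_anti X Y x : X \subset Y -> x \notin Y ->
  f (Y :|: [set x]) - f Y <= f (X :|: [set x]) - f X.
Proof.
move=> XY xY; have := subf (X :|: [set x]) Y.
have -> : X :|: [set x] :|: Y = Y :|: [set x].
  by rewrite setUAC (setUidPr XY).
have -> : (X :|: [set x]) :&: Y = X.
  rewrite setIUl (setIidPl XY); apply/setUidPl.
  by apply/subsetP=> y; rewrite !inE => /andP[/eqP->]; rewrite (negbTE xY).
lra.
Qed.

(** The elements of Y \ X are added one at a time, and [marginal_anti] bounds each increment by the
    marginal gain at X. *)
Lemma marginal_union X Y :
  f (Y :|: X) - f X <= \sum_(x in Y :\: X) (f (X :|: [set x]) - f X).
Proof.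
have -> : Y :|: X = X :|: [set x in enum (Y :\: X)].
  by apply/setP=> x; rewrite !inE mem_enum !inE orbC; case: (x \in X).
rewrite -big_enum.
have : all [predC X] (enum (Y :\: X)).
  by apply/allP => x; rewrite mem_enum !inE => /andP[].
elim: (enum _) (enum_uniq (Y :\: X)) => [|x s IH] /=.
  by rewrite big_nil set_nil setU0 subrr.
move=> /andP[xs us] /andP[xX sX]; rewrite big_cons.
have := IH us sX.
have -> : X :|: [set y in x :: s] = X :|: [set y in s] :|: [set x].
  apply/setP=> y; rewrite !inE.
  by do !case: (_ \in _) => //=; rewrite ?orbT ?orbF.
have := @marginal_anti X (X :|: [set y in s]) x.
rewrite subsetUl !inE (negbTE xs) orbF => /(_ isT xX); lra.
Qed.

End SubmodularFunctions.

(** * The charging invariant and the bound it yields *)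

Section Invariant.
Context {R : realType} {T : finType} {I : {set {set T}}} {f : {set T} -> R}.
Context {eps : R} {O : {set T}}.
Hypotheses (matI : matroid I) (subf : submodular f) (eps0 : 0 < eps).
Implicit Types (S A : bool -> {set T}) (g : bool -> T -> R) (e x : T).
Implicit Types (tau c : R) (i j : bool).

(** Bounds both values [Delta] of the algorithm by c; an infeasible side has value -oo and imposes
    nothing. *)
Definition gain_le c S e : Prop :=
  forall j, S j :|: [set e] \in I -> f (S j :|: [set e]) - f (S j) <= c.

Lemma gain_le_mono c S S' e : (forall j, S j \subset S' j) ->
  (forall j, e \notin S' j) -> gain_le c S e -> gain_le c S' e.
Proof.
move=> SS' eS' Se j S'eI.
apply: le_trans (marginal_anti subf (SS' j) (eS' j)) (Se j _).
by apply: indepS S'eI => //; apply: setSU.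
Qed.

Definition add_to S i e : bool -> {set T} :=
  fun j => if j == i then S j :|: [set e] else S j.

Lemma sub_add_to S i e j : S j \subset add_to S i e j.
Proof. by rewrite /add_to; case: eqP => // _; apply: subsetUl. Qed.

Lemma add_to_same S i e : add_to S i e i = S i :|: [set e].
Proof. by rewrite /add_to eqxx. Qed.

Lemma add_to_other S i e : add_to S i e (~~ i) = S (~~ i).
Proof. by case: i. Qed.

Definition potential S A g : R :=
  \sum_(j : bool) \sum_(x in O :\: S j :\: A j) g j x.

(** Telescopes to the sum of the gains of all insertions made from the empty sets. *)
Definition total S : R := \sum_(j : bool) (f (S j) - f set0).

Lemma sum_bool (F : bool -> R) i : \sum_j F j = F i + F (~~ i).
Proof. by rewrite big_bool; case: i; rewrite // addrC. Qed.

(* [A i] is the part of the optimum [O] that could still be added to [S i],   *)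
(* and [g i x] bounds the loss [f(x | S i)] of each element x of [O] that has *)
(* left [A i] without entering [S i]. An unselected such x may still enter    *)
(* [S i]; its bound, recorded at an earlier and higher threshold, then pays   *)
(* for the element of [A i] that this addition displaces ([acc_refund]).      *)
Record accounted tau S A g : Prop := Accounted {
  acc_indep : forall i, S i :|: A i \in I;
  acc_disj : forall i x, x \in S i -> x \notin S (~~ i);
  acc_fresh : forall i j x, x \in A i -> x \in O /\ x \notin S j;
  acc_loss : forall i x, x \in O :\: S i :\: A i ->
    f (S i :|: [set x]) - f (S i) <= g i x;
  acc_refund : forall i x, x \in O :\: S i :\: A i -> x \notin S (~~ i) ->
    (1 + eps) * tau <= g i x;
  acc_gain : forall e, (forall j, e \notin S j) ->
    gain_le ((1 + eps) * tau) S e;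
  acc_potential : potential S A g <= (1 + eps) * total S }.

Definition accountable tau S : Prop := exists A g, accounted tau S A g.

Lemma bool_cases i j : j = i \/ j = ~~ i.
Proof. by case: i j => [] [] /=; auto. Qed.

Lemma notin_both S i e : e \notin S i -> e \notin S (~~ i) ->
  forall j, e \notin S j.
Proof. by case: i => ? ? [|]. Qed.

(** The insertion earns (1 + eps) * delta. It may cost delta on the other side, if e leaves
    [A (~~ i)], and (1 + eps) * tau on side i, if an element is displaced; [poti] shows that what it
    earns suffices. *)
Lemma accountable_add tau S e i : 0 <= tau -> accountable tau S ->
  (forall j, e \notin S j) -> S i :|: [set e] \in I ->
  tau <= f (S i :|: [set e]) - f (S i) ->
  (S (~~ i) :|: [set e] \in I ->
     f (S (~~ i) :|: [set e]) - f (S (~~ i))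
       <= f (S i :|: [set e]) - f (S i)) ->
  accountable tau (add_to S i e).
Proof.
move=> tau0 [A [g [SAI disj fresh loss refund gain pot]]] eS SeI.
set delta := f (S i :|: [set e]) - f (S i) => tau_delta delta_max.
have e1 : 0 < 1 + eps by apply: addr_gt0.
have delta0 : 0 <= delta by apply: le_trans tau_delta.
(* The bound is a boolean read as 0 or 1: no element other than e is displaced when e was in [A i],
   and at most one otherwise. *)
have [A1 [A1A eA1 A1I]] : exists A1 : {set T}, [/\ A1 \subset A i,
    (#|A i :\: A1 :\ e| <= (e \notin A i))%N /\ e \notin A1
  & (S i :|: [set e]) :|: A1 \in I].
  have [eA|eA] /= := boolP (e \in A i).
    exists (A i :\ e); rewrite subD1set !inE eqxx; split=> //.
      rewrite leqn0 cards_eq0 -subset0; split=> //.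
      apply/subsetP=> x; rewrite !inE.
      by do !case: (_ \in _); rewrite ?andbF //; case: eqP.
    by rewrite -setUA setD1K.
  have [A1 A1A [c1 A1I]] := indep_exchange matI (SAI i) SeI.
  exists A1; split=> //; split.
    exact: leq_trans (subset_leq_card (subD1set _ _)) c1.
  by apply: contra eA; apply/subsetP.
case: eA1 => cD eA1.
set D := A i :\: A1 :\ e in cD.
have DA x : x \in D -> x \in A i by rewrite !inE => /and3P[].
pose A' j := if j == i then A1 else A j :\ e.
(* Displaced elements are charged at the current threshold; e is charged its own gain delta on the
   side that did not take it. *)
pose g' j x := if j == i then (if x \in D then (1 + eps) * tau else g j x)
               else if (x == e) && (e \in A j) then delta else g j x.
have A'A j : A' j \subset A j.
  by rewrite /A'; case: eqP => [->//|_]; apply: subD1set.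
have eA' j : e \notin A' j by rewrite /A'; case: ifP => // _; rewrite !inE eqxx.
have Ai : A' i = A1 by rewrite /A' eqxx.
have Aj : A' (~~ i) = A (~~ i) :\ e by rewrite /A'; case: (i).
have gi x : g' i x = if x \in D then (1 + eps) * tau else g i x.
  by rewrite /g' eqxx.
have gj x : g' (~~ i) x =
    if (x == e) && (e \in A (~~ i)) then delta else g (~~ i) x.
  by rewrite /g'; case: (i).
set Bi := O :\: S i :\: A i; set Bj := O :\: S (~~ i) :\: A (~~ i).
have Bi' : O :\: add_to S i e i :\: A' i = D :|: (Bi :\ e).
  rewrite add_to_same Ai; apply/setP => x; rewrite !inE.
  have [->|xe] := eqVneq x e; first by rewrite orbT /= ?andbF.
  rewrite orbF /=; have := fresh i i x; have := subsetP A1A x.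
  case: (x \in A1) => /= [->//|_].
  by case: (x \in A i) => //= /(_ isT)[-> /negbTE->].
have Bj' : O :\: add_to S i e (~~ i) :\: A' (~~ i) =
    if e \in A (~~ i) then e |: Bj else Bj.
  rewrite add_to_other Aj; apply/setP => x.
  case: ifP => eA; rewrite !inE; have [->|xe] //= := eqVneq x e.
    by have [-> ->] := fresh _ (~~ i) _ eA.
  by rewrite eA.
have DBi x : x \in D -> x \in Bi = false.
  by move=> /DA xA; rewrite inE xA.
have S'S j x : x \notin add_to S i e j -> x \notin S j.
  by apply: contra; apply: (subsetP (sub_add_to S i e j)).
have anti j x : x \in O :\: add_to S i e j :\: A' j ->
    f (add_to S i e j :|: [set x]) - f (add_to S i e j)
      <= f (S j :|: [set x]) - f (S j).
  rewrite !inE => /and3P[_ xS' _].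
  by apply: marginal_anti => //; apply: sub_add_to.
exists A', g'; split.
- move=> j; have [->|->] := bool_cases i j; first by rewrite add_to_same Ai.
  rewrite add_to_other.
  by apply: indepS (SAI (~~ i)) => //; apply: setUS.
- move=> j x; have [->|->] := bool_cases i j.
    rewrite add_to_same add_to_other !inE => /orP[/disj //|/eqP->]; exact: eS.
  rewrite negbK add_to_same add_to_other !inE => xS.
  rewrite negb_or -{1}[i]negbK disj //=.
  by apply: contraTneq xS => ->; apply: eS.
- move=> j k x xA'; have xA := subsetP (A'A j) _ xA'.
  have [xO xS] := fresh _ k _ xA; split=> //.
  rewrite /add_to; case: ifP => // _; rewrite !inE negb_or xS /=.
  by apply: contraNneq (eA' j) => <-.
- move=> j x xB; apply: le_trans (anti _ _ xB) _; move: xB.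
  have [->|->] := bool_cases i j.
    rewrite Bi' gi inE; case: ifP => /= [xD _|_ /setD1P[_]]; last exact: loss.
    (* A displaced x came from [A i], so it was unselected and feasible for [S i], and [acc_gain]
       applies. *)
    have [_ xSi] := fresh i i x (DA _ xD).
    have [_ xSj] := fresh i (~~ i) x (DA _ xD).
    apply: gain; first exact: notin_both xSi xSj.
    apply: indepS (SAI i) => //; apply: setUS.
    by rewrite sub1set DA.
  rewrite Bj' gj; have [eA|_] := boolP (e \in A (~~ i)); last first.
    by rewrite andbF; apply: loss.
  rewrite andbT 2!inE; case: eqVneq => [-> _|_] /=; last exact: loss.
  (* Membership of e in [A (~~ i)] makes the other side feasible, so the greedy choice of i bounds
     its gain by delta. *)
  apply: delta_max; apply: indepS (SAI (~~ i)) => //.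
  by apply: setUS; rewrite sub1set.
- move=> j x; have [->|->] := bool_cases i j.
    rewrite Bi' gi inE add_to_other; case: ifP => //= _ /setD1P[_].
    exact: refund.
  rewrite Bj' gj negbK add_to_same => xB.
  rewrite !inE negb_or => /andP[xS xe]; rewrite (negbTE xe).
  apply: refund; rewrite ?negbK //.
  by move: xB; case: ifP => // _; rewrite 2!inE (negbTE xe).
- move=> x xS'; apply: gain_le_mono (gain _ _) => // j; first exact: sub_add_to.
  exact/S'S.
have potj : \sum_(x in O :\: add_to S i e (~~ i) :\: A' (~~ i)) g' (~~ i) x
    <= \sum_(x in Bj) g (~~ i) x + (e \in O)%:R * delta.
  rewrite Bj'; under eq_bigr do rewrite gj.
  have [eA|_] := boolP (e \in A (~~ i)); last first.
    under eq_bigr do rewrite andbF.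
    by rewrite lerDl mulr_ge0.
  have [-> _] := fresh _ i _ eA.
  rewrite big_setU1 /=; last by rewrite !inE eA.
  rewrite eqxx mul1r addrC lerD2r le_eqVlt; apply/orP; left; apply/eqP.
  apply: eq_bigr => x; rewrite andbT; case: eqVneq => // ->.
  by rewrite inE eA.
(* The cost of the other side is included here. If e is in [A i], only delta is due. If e is in O
   but not in [A i], its old bound leaves the sum and covers the displaced element. If e is not in
   O, the other side costs nothing. *)
have poti : \sum_(x in O :\: add_to S i e i :\: A' i) g' i x
    + (e \in O)%:R * delta <= \sum_(x in Bi) g i x + (1 + eps) * delta.
  have deltaE : delta <= (1 + eps) * delta.
    by rewrite mulrDl mul1r lerDl mulr_ge0 // ltW.
  have tauE : (1 + eps) * tau <= (1 + eps) * delta by rewrite ler_pM2l.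
  have tauE0 : 0 <= (1 + eps) * tau by rewrite mulr_ge0 // ltW.
  have g'D : \sum_(x in D) g' i x = (1 + eps) * tau *+ #|D|.
    by rewrite -sumr_const; apply: eq_bigr => x xD; rewrite gi xD.
  have g'B : \sum_(x in Bi :\ e) g' i x = \sum_(x in Bi :\ e) g i x.
    apply: eq_bigr => x /setD1P[_ xB]; rewrite gi.
    by case: ifP => // /DBi; rewrite xB.
  have disjDB : [disjoint D & Bi :\ e].
    rewrite -setI_eq0 -subset0; apply/subsetP=> x /setIP[/DBi xB /setD1P[_]].
    by rewrite xB.
  rewrite Bi' (eq_bigl _ _ (fun x => in_setU x _ _)) bigU // g'D g'B /=.
  have [eA|eA] := boolP (e \in A i).
    have [eO _] := fresh i i e eA.
    have eBi : e \notin Bi by rewrite inE eA.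
    move: cD; rewrite eA leqn0 => /eqP->.
    have -> : Bi :\ e = Bi by apply/setDidPl; rewrite disjoint_sym disjoints1.
    by rewrite mulr0n add0r eO mul1r lerD2l.
  have leD : (1 + eps) * tau *+ #|D| <= (1 + eps) * tau.
    by move: cD; rewrite eA; case: #|D| => [|[|]] //; rewrite mulr0n.
  have [eO|eO] := boolP (e \in O).
    have eBi : e \in Bi by rewrite !inE eA eS eO.
    rewrite [leRHS](_ : _ = g i e + \sum_(x in Bi :\ e) g i x
                            + (1 + eps) * delta); last by rewrite (big_setD1 e).
    have ge := refund i e eBi (eS _).
    by rewrite mul1r addrAC; lra.
  have eBi : e \notin Bi by rewrite !inE (negbTE eO) !andbF.
  have -> : Bi :\ e = Bi by apply/setDidPl; rewrite disjoint_sym disjoints1.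
  by rewrite mul0r addr0 addrC lerD2l (le_trans leD).
have total_add : total (add_to S i e) = total S + delta.
  by rewrite /total !(sum_bool _ i) add_to_same add_to_other /delta; ring.
move: pot; rewrite total_add mulrDr /potential !(sum_bool _ i) -/Bi -/Bj; lra.
Qed.

Lemma accountable_init tau : nonnegative f -> O \in I -> 0 <= tau ->
  (forall e, [set e] \in I -> f [set e] <= tau) ->
  accountable tau (fun=> set0).
Proof.
(* All of O is still addable on both sides, so no loss is recorded and the value 0 is a dummy. *)
move=> f0 OI tau0 tau_max; exists (fun=> O), (fun _ _ => 0).
have noB x : (x \in O :\: set0 :\: O) = false.
  by rewrite !inE; case: (x \in O).
split=> //.
- by move=> i; rewrite set0U.
- by move=> i x; rewrite inE.
- by move=> i j x xO; rewrite inE.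
- by move=> i x; rewrite noB.
- by move=> i x; rewrite noB.
- move=> e _ j; rewrite set0U => /tau_max le.
  have := f0 set0; have : tau <= (1 + eps) * tau.
    by rewrite mulrDl mul1r lerDl mulr_ge0 // ltW.
  lra.
rewrite /potential /total big1 => [|j _]; last by apply: big1 => x; rewrite noB.
by rewrite big1 ?mulr0 // => j _; rewrite subrr.
Qed.

Lemma accountable_lower tau tau' S : tau' <= tau ->
  (forall e, (forall j, e \notin S j) -> gain_le ((1 + eps) * tau') S e) ->
  accountable tau S -> accountable tau' S.
Proof.
move=> le gain' [A [g [SAI disj fresh loss refund gain pot]]].
exists A, g; split=> // i x xB xS; apply: le_trans (refund i x xB xS).
by rewrite ler_pM2l // addr_gt0.
Qed.

Lemma accountable_indep tau S i : accountable tau S -> S i \in I.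
Proof.
by case=> A [g [SAI *]]; apply: indepS (SAI i) => //; apply: subsetUl.
Qed.

Lemma accountable_bound tau S : nonnegative f -> 0 <= tau ->
  accountable tau S ->
  f O <= (2 + eps) * (f (S false) + f (S true))
         + 2 * (#|O|%:R * ((1 + eps) * tau)).
Proof.
move=> f0 tau0 [A [g [SAI disj fresh loss refund gain pot]]].
have tau0' : 0 <= (1 + eps) * tau by rewrite mulr_ge0 // addr_ge0 // ltW.
have side i : f (O :|: S i) - f (S i) <=
    \sum_(x in O :\: S i :\: A i) g i x + #|O|%:R * ((1 + eps) * tau).
  apply: le_trans (marginal_union subf _ _) _.
  rewrite (big_setID (A i)) /= addrC lerD //.
    by apply: ler_sum => x; apply: loss.
  apply: (@le_trans _ _ (\sum_(x in (O :\: S i) :&: A i) (1 + eps) * tau)).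
    apply: ler_sum => x /setIP[_ xA]; apply: gain.
      by move=> j; have [] := fresh i j x xA.
    apply: indepS (SAI i) => //; apply: setUS.
    by rewrite sub1set.
  rewrite sumr_const -[leLHS]mulr_natl ler_wpM2r // ler_nat subset_leq_card //.
  by apply: subset_trans (subsetIl _ _) (subsetDl _ _).
(* The two sets meet in O because the solutions are disjoint; the value of their union is dropped as
   non-negative. *)
have cross : f O <= f (O :|: S false) + f (O :|: S true).
  apply: le_trans (subf _ _); rewrite -setUIr.
  have -> : S false :&: S true = set0.
    apply/setP=> x; rewrite !inE; apply/andP=> -[/disj] /=.
    by move=> /negbTE->.
  by rewrite setU0 lerDr.
move: pot (side false) (side true) (f0 set0); rewrite /potential /total.
rewrite !(sum_bool _ false) /= => pot sf st z.
have : (1 + eps) * (f (S false) - f set0 + (f (S true) - f set0)) <=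
    (1 + eps) * (f (S false) + f (S true)).
  by rewrite ler_pM2l ?addr_gt0 //; lra.
lra.
Qed.

End Invariant.

(** * Outcomes and query counts of all runs *)

Section Runs.
Context {R : realType} {T : finType} (I : {set {set T}}) (f : {set T} -> R).

Lemma all_runs_bind (A B : Type) (p : prog R T A) (q : A -> prog R T B) t
    (P : A -> nat -> Prop) (Q : B -> nat -> Prop) :
  all_runs f I p t P -> (forall a t', P a t' -> all_runs f I (q a) t' Q) ->
  all_runs f I (bind p q) t Q.
Proof.
move=> + PQ; elim: p t => [a|X k IH|X k IH|C D k IH] t /=.
- exact: PQ.
- exact: IH.
- exact: IH.
- by move=> [ex all]; split=> // c /all; apply: IH.
Qed.

Lemma all_runs_mono (A : Type) (p : prog R T A) t (P Q : A -> nat -> Prop) :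
  all_runs f I p t P -> (forall a t', P a t' -> Q a t') -> all_runs f I p t Q.
Proof.
move=> + PQ; elim: p t => [a|X k IH|X k IH|C D k IH] t /=.
- exact: PQ.
- exact: IH.
- exact: IH.
- by move=> [ex all]; split=> // c /all; apply: IH.
Qed.

Lemma ex_argmax (d : Order.disp_t) (D : orderType d) (v : bool -> D) :
  exists i, is_argmax v i.
Proof.
have [le|lt] := leP (v false) (v true).
  by exists true => -[].
by exists false => -[] //; apply: ltW.
Qed.

Lemma singleton_values_runs s t :
  all_runs f I (singleton_values s) t (fun ys t' =>
    ys = [seq f [set e] | e <- s & [set e] \in I] /\ (t' <= t + 2 * size s)%N).
Proof.
elim: s t => [|e s IH] t /=; first by rewrite muln0 addn0.
case: ifP => eI /=.
  apply: all_runs_bind (IH _) _ => ys t' [-> le] /=; split=> //.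
  by rewrite mulnS addnA addn2.
apply: all_runs_mono (IH _) _ => ys t' [-> le]; split=> //.
by apply: leq_trans le _; rewrite mulnS addnA addn2 addSn leqnSn.
Qed.

Lemma gain_runs (X : {set T}) e t :
  all_runs f I (gain X e) t (fun d t' =>
    d = (if X :|: [set e] \in I then (f (X :|: [set e]) - f X)%:E else -oo%E)
    /\ (t' <= t + 3)%N).
Proof.
rewrite /gain /=; case: ifP => _ /=; split=> //; rewrite addn3 //.
by rewrite ltnS ltnW.
Qed.

Lemma process_runs tau (S : bool -> {set T}) e t :
  all_runs f I (process tau S e) t (fun S' t' => (t' <= t + 6)%N /\
    ((S' = S /\ gain_le (I := I) (f := f) tau S e) \/
     exists i, [/\ S' = add_to S i e, S i :|: [set e] \in I,
       tau <= f (S i :|: [set e]) - f (S i) &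
       S (~~ i) :|: [set e] \in I ->
         f (S (~~ i) :|: [set e]) - f (S (~~ i))
           <= f (S i :|: [set e]) - f (S i)])).
Proof.
apply: all_runs_bind (gain_runs _ _ _) _ => d1 t1 [d1E t1E].
apply: all_runs_bind (gain_runs _ _ _) _ => d2 t2 [d2E t2E] /=.
set Delta := fun j : bool => if j then d2 else d1.
have DeltaE j : Delta j = if S j :|: [set e] \in I
    then (f (S j :|: [set e]) - f (S j))%:E else -oo%E.
  by case: j.
split; first exact: ex_argmax.
move=> i max_i; split.
  by apply: leq_trans t2E _; rewrite -(leq_add2r 3) -addnA in t1E.
have [tau_le|tau_gt] := leP tau%:E (Delta i); last first.
  left; split=> // j SjI.
  have := le_lt_trans (max_i j) tau_gt.
  by rewrite DeltaE SjI lte_fin => /ltW.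
right; exists i; move: tau_le (max_i (~~ i)).
(* An infeasible side cannot be accepted: its value -oo is below the finite tau. *)
rewrite !DeltaE; case: ifP => // SI tau_le le; split=> //.
by move=> S'I; move: le; rewrite S'I lee_fin.
Qed.

Lemma best_of_two_runs (S : bool -> {set T}) t :
  all_runs f I (best_of_two S) t (fun X t' => t' = t.+2 /\
    exists i, X = S i /\ forall j, f (S j) <= f (S i)).
Proof.
rewrite /best_of_two /=; split; first exact: ex_argmax.
move=> i max_i; split=> //; exists i; split=> // j.
by have := max_i j; case: i j {max_i} => -[].
Qed.

Context (eps : R) (O : {set T}).
Hypotheses (matI : matroid I) (subf : submodular f) (eps0 : 0 < eps).
Local Notation accountable := (@accountable R T I f eps O).
Local Notation gain_le := (@gain_le R T I f).

(** A rejected element has gain at most tau on each feasible side when it is examined, and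
    submodularity preserves this as the solutions grow. *)
Lemma scan_runs tau s (S : bool -> {set T}) t :
  0 <= tau -> accountable tau S -> uniq s ->
  (forall e j, e \in s -> e \notin S j) ->
  all_runs f I (scan tau s S) t (fun S' t' =>
    [/\ (t' <= t + 6 * size s)%N, accountable tau S',
        forall j, S j \subset S' j
      & forall e, e \in s -> (forall j, e \notin S' j) -> gain_le tau S' e]).
Proof.
move=> tau0; elim: s S t => [|e s IH] S t accS /=.
  by move=> _ _; split; rewrite ?muln0 ?addn0.
move=> /andP[es us] sS.
apply: all_runs_bind (process_runs _ _ _ _) _ => S1 t1 [t1E S1E].
have eS j : e \notin S j by apply: sS; rewrite mem_head.
have [accS1 SS1 S1s gain1] : [/\ accountable tau S1, forall j, S j \subset S1 j,
    forall x j, x \in s -> x \notin S1 j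
  & (forall j, e \notin S1 j) -> gain_le tau S1 e].
  case: S1E => [[-> gaine]|[i [-> SeI tau_le max_i]]].
    by split=> // x j xs; apply: sS; rewrite inE xs orbT.
  split; first exact: accountable_add.
  - exact: sub_add_to.
  - move=> x j xs; have xS : x \notin S j by apply: sS; rewrite inE xs orbT.
    rewrite /add_to; case: ifP => // _; rewrite !inE negb_or xS /=.
    by apply: contraNneq es => <-.
  - by move/(_ i); rewrite add_to_same !inE eqxx orbT.
apply: all_runs_mono (IH _ _ accS1 us S1s) _ => S2 t2 [t2E accS2 S12 gain2].
split=> //.
- by apply: leq_trans t2E _; rewrite mulnS addnA leq_add2r.
- by move=> j; apply: subset_trans (SS1 j) (S12 j).
move=> x; rewrite inE => /predU1P[->|xs] xS2; last exact: gain2.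
apply: gain_le_mono (gain1 _) => // j.
by apply: contra (xS2 j); apply: subsetP (S12 j) _.
Qed.

(** Every element unselected at the end was scanned and rejected, so its gains are at most tau,
    which is 1 + eps times the next threshold: this restores [acc_gain]. *)
Lemma pass_runs tau (S : bool -> {set T}) t : 0 <= tau -> accountable tau S ->
  all_runs f I (pass tau S) t (fun S' t' =>
    (t' <= t + 6 * #|T|)%N /\ accountable (tau / (1 + eps)) S').
Proof.
move=> tau0 accS; split; first by exists (enum (~: (S false :|: S true))).
have e1 : 1 + eps != 0 by rewrite gt_eqF // addr_gt0.
have mem_fresh s e : perm_eq s (enum (~: (S false :|: S true))) ->
    e \in s = (e \notin S false) && (e \notin S true).
  by move=> /perm_mem->; rewrite mem_enum !inE negb_or.
move=> s s_perm.
have us : uniq s by rewrite (perm_uniq s_perm) enum_uniq.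
have sS e j : e \in s -> e \notin S j.
  by rewrite (mem_fresh s) // => /andP[]; case: j.
apply: all_runs_mono (scan_runs _ _ accS us sS) _ => //.
move=> S' t' [t'E accS' SS' gain'].
split.
  apply: leq_trans t'E _; rewrite leq_add2l leq_mul2l /=.
  by rewrite -(card_uniqP us) max_card.
apply: accountable_lower accS' => //.
  rewrite ler_pdivrMr ?addr_gt0 // mulrDr mulr1 lerDl mulr_ge0 //.
  exact: ltW.
move=> e eS'; rewrite mulrC divfK //; apply: gain' => //.
rewrite (mem_fresh s) //; apply/andP; split.
  by apply: contra (eS' false); apply: subsetP.
by apply: contra (eS' true); apply: subsetP.
Qed.

(** Each pass removes one factor 1 + eps, so at most m passes occur and fuel m never runs out. *)
Lemma threshold_loop_runs m fuel bound tau (S : bool -> {set T}) t :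
  (m <= fuel)%N -> 0 <= bound -> 0 <= tau -> tau <= bound * (1 + eps) ^+ m ->
  accountable tau S ->
  all_runs f I (threshold_loop eps fuel bound tau S) t (fun o t' =>
    (t' <= t + m * (6 * #|T|))%N /\
    exists S' tau', [/\ o = Some S', 0 <= tau', tau' <= bound
      & accountable tau' S']).
Proof.
have e1 : 0 < 1 + eps by apply: addr_gt0.
elim: m fuel tau S t => [|m IH] fuel tau S t mf bound0 tau0 tau_le accS.
  move: tau_le; rewrite expr0 mulr1 => tau_le.
  case: fuel mf => [|fuel] _ /=; rewrite ltNge tau_le /= mul0n addn0 leqnn;
    by split=> //; exists S, tau.
case: fuel mf => // fuel mf /=; case: ltP => [_|le] /=; last first.
  by split; [exact: leq_addr|exists S, tau].
apply: all_runs_bind (pass_runs _ tau0 accS) _ => S1 t1 [t1E acc1].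
apply: all_runs_mono (IH fuel (tau / (1 + eps)) S1 t1 mf bound0 _ _ acc1) _.
- by rewrite divr_ge0 // ltW.
- by rewrite ler_pdivrMr // -mulrA -exprSr.
move=> o t' [t'E ex]; split=> //.
by apply: leq_trans t'E _; rewrite (mulSn m) addnA leq_add2r.
Qed.

End Runs.

(** * The maximum of a list *)

Section SeqMax.
Context {R : realType}.
Implicit Types (ys : seq R) (y c : R).

Lemma le_seq_max ys y : y \in ys -> y <= seq_max ys.
Proof. by move=> yys; apply: le_bigmax_seq. Qed.

Lemma seq_max_le ys c : 0 <= c -> (forall y, y \in ys -> y <= c) ->
  seq_max ys <= c.
Proof.
move=> c0 ysc; rewrite /seq_max big_seq; apply: bigmax_le => //.
(* The base value is the head of the list, or 0 when the list is empty, which is where 0 <= c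
   enters. *)
by case: ys ysc => //= y ys ysc; apply: ysc; rewrite mem_head.
Qed.

Lemma seq_max_ge0 ys : (forall y, y \in ys -> 0 <= y) -> 0 <= seq_max ys.
Proof.
move=> ys0; apply: le_trans (bigmax_ge_id _ _ _ _).
by case: ys ys0 => //= y ys; apply; rewrite mem_head.
Qed.

End SeqMax.

(** * Logarithmic bound on the number of passes *)

Section PassCount.
Context {R : realType}.
Implicit Types x eps q : R.

(** This is ln (1 + y) <= y at y = 1/x - 1. *)
Lemma ln_ge_1BV x : 0 < x -> 1 - x^-1 <= ln x.
Proof.
move=> x0; have := @le_ln1Dx R (x^-1 - 1).
have -> : 1 + (x^-1 - 1) = x^-1 by ring.
rewrite lnV // ltrBrDl subrr invr_gt0 => /(_ x0).
lra.
Qed.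

Lemma ex_pass_count eps q : 0 < eps < 1 -> 1 <= q ->
  exists m : nat, q * (1 + eps) <= (1 + eps) ^+ m /\
    m%:R <= 2 + 2 * (ln q / eps).
Proof.
move=> /andP[eps0 eps1] q1; have q0 : 0 < q by apply: lt_le_trans q1.
have e0 : 0 < 1 + eps by apply: addr_gt0.
have lnq0 : 0 <= ln q by apply: ln_ge0.
(* ln (1 + eps) >= eps / (1 + eps) >= eps / 2, as eps < 1. *)
have le_ln : eps / 2 <= ln (1 + eps).
  apply: le_trans (ln_ge_1BV e0).
  rewrite -subr_ge0.
  have -> : 1 - (1 + eps)^-1 - eps / 2 = eps * (1 - eps) / 2 / (1 + eps).
    by field; rewrite gt_eqF.
  by rewrite !divr_ge0 ?mulr_ge0 // ?ltW // subr_gt0.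
have ln0 : 0 < ln (1 + eps) by apply: lt_le_trans le_ln; apply: divr_gt0.
have y0 : 0 <= ln q / ln (1 + eps) by apply: divr_ge0 => //; apply: ltW.
have /andP[lo hi] := trunc_itv y0.
(* One successor rounds the truncated logarithm up; the other supplies the extra factor 1 + eps. *)
exists (Num.trunc (ln q / ln (1 + eps))).+2; split.
  rewrite exprSr ler_pM2r // -ler_ln ?posrE ?exprn_gt0 // lnXn // -mulr_natl.
  by rewrite -ler_pdivrMr // ltW.
rewrite -addn2 natrD addrC lerD2l; apply: le_trans lo _.
rewrite ler_pdivrMr //.
have -> : 2 * (ln q / eps) * ln (1 + eps) = ln q * (ln (1 + eps) / (eps / 2)).
  by field; rewrite gt_eqF.
by rewrite ler_peMr // ler_pdivlMr ?divr_gt0 // mul1r.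
Qed.

End PassCount.

(** * Approximation ratio and query bound *)

Lemma opt_attained (R : realType) (T : finType) (I : {set {set T}})
    (f : {set T} -> R) : set0 \in I ->
  exists O, [/\ O \in I, opt f I = f O & forall X, X \in I -> f X <= f O].
Proof.
move=> I0; case: (@arg_maxP _ _ _ set0 (mem I) f I0) => O OI max_O.
exists O; split=> //; apply/le_anti; rewrite le_bigmax_cond // andbT.
by apply: bigmax_le => [|X]; apply: max_O.
Qed.

(** The hypothesis reads (1 - 2 eps) a <= (4 + 2 eps) b, and (4 + 2 eps)(1/4 - eps) = 1 - 7/2 eps -
    2 eps^2 <= 1 - 2 eps. *)
Lemma quarter_ratio (R : realType) (eps a b : R) : 0 < eps -> 0 <= a ->
  a <= (2 + eps) * (2 * b) + 2 * (eps * a) -> (4^-1 - eps) * a <= b.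
Proof.
move=> eps0 a0 h; have e0 : 0 < 4 + 2 * eps by lra.
rewrite -(ler_pM2l e0).
have : 0 <= eps * a by rewrite mulr_ge0 // ltW.
have : 0 <= eps * (eps * a) by rewrite !mulr_ge0 // ltW.
have -> : (4 + 2 * eps) * ((4^-1 - eps) * a) =
  a - 7 / 2 * (eps * a) - 2 * (eps * (eps * a)) by field.
nra.
Qed.

Theorem theorem2 :
  exists C : nat,
  forall (R : realType) (T : finType) (I : {set {set T}}) (f : {set T} -> R)
         (eps : R) (n r : nat),
    matroid I -> #|T| = n -> rank I = r -> (1 <= r)%N ->
    nonmonotone f -> nonnegative f -> submodular f ->
    0 < eps < 1 ->
    exists fuel0 : nat, forall fuel : nat, (fuel0 <= fuel)%N ->
      all_runs f I (twin_greedy_fast eps r fuel) 0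
        (fun (out : option {set T}) (t : nat) =>
           exists Sstar : {set T},
             [/\ out = Some Sstar,
                 Sstar \in I,
                 f Sstar >= (4^-1 - eps) * opt f I &
                 2 <= r%:R / eps ->
                 t%:R <= C%:R * (n%:R / eps * ln (r%:R / eps))]).
Proof.
(* With L = ln (r / eps), the count is at most 2n + 6nm + 2 <= 16n + 12n L / eps, and n <= 2n L /
   eps turns this into 32 + 12 = 44. *)
exists 44%N => R T I f eps n r matI cT rankI r1 _ f0 subf eps01.
have /andP[eps0 eps1] := eps01.
have e0 : 0 < 1 + eps by apply: addr_gt0.
have r0 : 0 < r%:R :> R by rewrite ltr0n.
have n1 : (1 <= n)%N.
  apply: leq_trans r1 _; rewrite -rankI -cT.
  by apply/bigmax_leqP => X _; apply: max_card.
have [O [OI opt_O max_O]] := opt_attained f (indep0 matI).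
have q1 : 1 <= r%:R / eps.
  by rewrite ler_pdivlMr // mul1r (le_trans (ltW eps1)) // ler1n.
have [m [m_ge m_le]] := ex_pass_count eps01 q1.
exists m => fuel m_fuel; rewrite /twin_greedy_fast.
apply: all_runs_bind (singleton_values_runs _ _ _ _) _ => ys t1 [ysE t1E].
set tmax := seq_max ys; set bound := eps * tmax / (r%:R * (1 + eps)).
have ysP y : y \in ys -> exists2 e, [set e] \in I & y = f [set e].
  rewrite ysE => /mapP[e]; rewrite mem_filter => /andP[eI _] ->.
  by exists e.
have tmax0 : 0 <= tmax by apply: seq_max_ge0 => y /ysP[e _ ->].
have tmax_O : tmax <= f O.
  by apply: seq_max_le => // y /ysP[e eI ->]; apply: max_O.
have tmaxP e : [set e] \in I -> f [set e] <= tmax.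
  move=> eI; apply: le_seq_max; rewrite ysE; apply/mapP; exists e => //.
  by rewrite mem_filter eI mem_enum.
have bound0 : 0 <= bound.
  by rewrite divr_ge0 ?mulr_ge0 // ltW.
(* The ratio of [tmax] to [bound] is (r / eps)(1 + eps), the quantity that m was chosen to
   dominate. *)
have tmax_le : tmax <= bound * (1 + eps) ^+ m.
  apply: (@le_trans _ _ (bound * (r%:R / eps * (1 + eps)))); last first.
    exact: ler_wpM2l.
  rewrite le_eqVlt; apply/orP; left; apply/eqP; rewrite /bound.
  by field; rewrite !gt_eqF.
have acc0 := accountable_init eps0 f0 OI tmax0 tmaxP.
apply: all_runs_bind
  (threshold_loop_runs matI subf eps0 t1 m_fuel bound0 tmax0 tmax_le acc0) _.
move=> _ t2 [t2E [S [tau [-> tau0 tau_le accS]]]].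
apply: all_runs_bind (best_of_two_runs _ _ _ _) _.
move=> _ t3 [-> [i [-> max_i]]] /=.
exists (S i); split=> //.
- exact: accountable_indep accS.
- rewrite opt_O.
  apply: quarter_ratio => //.
  apply: le_trans (accountable_bound _ _ _ _ _ accS) _ => //.
  rewrite lerD //.
    rewrite ler_pM2l ?addr_gt0 // mulr_natl mulr2n.
    by rewrite lerD.
  (* The residual losses are small: |O| <= r, and r (1 + eps) [bound] = eps [tmax] <= eps f(O). *)
  rewrite ler_pM2l //; apply: (@le_trans _ _ (r%:R * ((1 + eps) * bound))).
    apply: ler_pM; rewrite ?ler0n ?(mulr_ge0 (ltW e0)) //.
      by rewrite ler_nat -rankI; apply: indep_card_le_rank.
    by rewrite ler_pM2l.
  have -> : r%:R * ((1 + eps) * bound) = eps * tmax.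
    by rewrite /bound; field; rewrite !gt_eqF.
  by rewrite ler_pM2l.
move=> q2; set L := ln (r%:R / eps) in m_le *.
(* L >= 1 - eps / r >= 1/2 since r / eps >= 2; this lets the constant terms be absorbed. *)
have L2 : 1 / 2 <= L.
  apply: le_trans _ (ln_ge_1BV (lt_le_trans ltr01 q1)).
  have : (r%:R / eps)^-1 <= 2^-1 by rewrite lef_pV2 ?posrE // divr_gt0.
  lra.
have n0 : 0 < n%:R :> R by rewrite ltr0n.
have -> : n%:R / eps * L = n%:R * (L / eps) by rewrite mulrAC mulrA.
have Leps : 1 / 2 <= L / eps.
  by rewrite ler_pdivlMr //; lra.
have t_le : (t2.+2 <= 2 * n + m * (6 * n) + 2)%N.
  rewrite -addn2 leq_add2r (leq_trans t2E) // cT leq_add2r.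
  by apply: leq_trans t1E _; rewrite -cardE cT.
apply: (@le_trans _ _ (2 * n + m * (6 * n) + 2)%:R); first by rewrite ler_nat.
have n1' : 1 <= n%:R :> R by rewrite ler1n.
have mn : m%:R * n%:R <= (2 + 2 * (L / eps)) * n%:R by rewrite ler_pM2r.
have Ln : 1 / 2 * n%:R <= (L / eps) * n%:R by rewrite ler_pM2r.
rewrite !natrD !natrM; lra.
Qed.
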